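(* Let $0<p<1$, let $\{X_n,\ n\ge1\}$ be the steps of the elephant random walk that remembers only the first step, with $P(X_1=1)=p=1-P(X_1=-1)$, and let $S_n=\sum_{k=1}^n X_k$. Then: (a) as $n\to\infty$, $\dfrac{S_n}{n}$ converges in distribution to a random variable equal to $2p-1$ with probability $p$ and to $-(2p-1)$ with probability $1-p$; (b) $E(S_n/n)\to(2p-1)^2$ and $\mathrm{Var}(S_n/n)\to 4p(1-p)(2p-1)^2$ as $n\to\infty$.
   Context: Elephant random walk remembering only the first step: for every $n\ge1$, $X_{n+1}=X_1$ with probability $p$ and $X_{n+1}=-X_1$ with probability $1-p$, i.e. $X_{n+1}=\varepsilon_{n+1}X_1$ where $\varepsilon_2,\varepsilon_3,\dots$ are i.i.d. with $P(\varepsilon_i=1)=p=1-P(\varepsilon_i=-1)$ and independent of $X_1$. *)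

(* Defs.v *)
From HB Require Import structures.
From mathcomp Require Import all_boot all_order all_algebra finmap.
From mathcomp Require Import all_classical all_reals all_analysis.
From mathcomp Require Import measurable_realfun.

Set Implicit Arguments.
Unset Strict Implicit.
Unset Printing Implicit Defensive.

Import Order.TTheory GRing.Theory Num.Theory.
Import numFieldNormedType.Exports.

Local Open Scope classical_set_scope.
Local Open Scope ring_scope.

Section Independence.
Context {d : measure_display} {T : measurableType d} {R : realType}.
Variable P : probability T R.

(* Product rule over every finite subfamily; only indices in I matter. *)
Definition mutually_independent (I : set nat) (Y : nat -> {RV P >-> R}) : Prop :=
  forall (J : {fset nat}) (A : nat -> set R),
    [set` J] `<=` I -> (forall i, measurable (A i)) ->
    P (\bigcap_(i in [set` J]) (Y i @^-1` A i))
    = (\prod_(i <- J) P (Y i @^-1` A i))%E.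

Definition independent_classes (F G : set (set T)) : Prop :=
  forall A B, F A -> G B -> P (A `&` B) = (P A * P B)%E.

Definition sigma_RV (Y : {RV P >-> R}) : set (set T) :=
  preimage_set_system setT Y measurable.

Definition sigma_family (I : set nat) (Y : nat -> {RV P >-> R}) : set (set T) :=
  <<s \bigcup_(i in I) sigma_RV (Y i) >>.

End Independence.

Section ElephantRandomWalk.
Context {d : measure_display} {T : measurableType d} {R : realType}.
Variable P : probability T R.

Definition sign_law (p : R) (Y : {RV P >-> R}) : Prop :=
  P (Y @^-1` [set 1]) = p%:E /\ P (Y @^-1` [set -1]) = (1 - p)%:E.

(* Steps and innovations are indexed as in X_1, X_2, ... and eps_2, eps_3, ...;
   the values X 0, eps 0 and eps 1 are unconstrained and never used.  The
   sign law makes the eps i identically distributed, and equality between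
   random variables is almost sure equality. *)
Definition first_step_erw (p : R) (X : nat -> {RV P >-> R}) : Prop :=
  exists eps : nat -> {RV P >-> R},
    [/\ mutually_independent [set i | (2 <= i)%N] eps,
        forall i, (2 <= i)%N -> sign_law p (eps i),
        independent_classes P (sigma_RV (X 1))
          (sigma_family [set i | (2 <= i)%N] eps)
      & forall n, (1 <= n)%N ->
          {ae P, forall w, X n.+1 w = eps n.+1 w * X 1 w}].

Definition walk (X : nat -> {RV P >-> R}) (n : nat) : T -> R :=
  fun w => \sum_(1 <= k < n.+1) X k w.

Definition walk_mean (X : nat -> {RV P >-> R}) (n : nat) : T -> R :=
  fun w => walk X n w / n%:R.

Lemma measurable_walk_mean (X : nat -> {RV P >-> R}) (n : nat) :
  measurable_fun setT (walk_mean X n).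
Proof.
apply: measurable_funM; last exact: measurable_cst.
by apply: measurable_sum => i; exact: measurable_funPT.
Qed.

HB.instance Definition _ (X : nat -> {RV P >-> R}) (n : nat) :=
  isMeasurableFun.Build _ _ _ _ (walk_mean X n) (measurable_walk_mean X n).

End ElephantRandomWalk.

(* The law is given as a mixture of Dirac masses, so that it remains correct
   when a = b (then Y = a almost surely). *)
Definition two_point_law (d : measure_display) (T : measurableType d)
    (R : realType) (Q : probability T R) (Z : {RV Q >-> R}) (a b p : R) : Prop :=
  forall A : set R, measurable A ->
    distribution Q Z A = (p%:E * \d_a A + (1 - p)%:E * \d_b A)%E.

(* The limit Z may live on another probability space than the Y n. *)
Definition cvg_in_distribution (R : realType)
    (d : measure_display) (T : measurableType d) (P : probability T R)
    (d' : measure_display) (T' : measurableType d') (Q : probability T' R)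
    (Y : nat -> {RV P >-> R}) (Z : {RV Q >-> R}) : Prop :=
  forall x : R, {for x, continuous (cdf Z)} ->
    cdf (Y n) x @[n --> \oo] --> cdf Z x.

(* Main.v *)
(* With m = 2p - 1 and M_n = (1 + eps_2 + ... + eps_n) / n one has
   S_n / n = X_1 M_n almost surely.  Since X_1^2 = 1,
   E[(S_n / n - m X_1)^2] = E[(M_n - m)^2], which is O(1 / n) because the eps_i
   are pairwise uncorrelated with mean m.  Thus S_n / n tends to m X_1 in mean
   square, which gives the limits of the mean and of the variance and, by
   Markov's inequality, the convergence in distribution. *)

Require Import Defs.
From HB Require Import structures.
From mathcomp Require Import all_boot all_order all_algebra finmap.
From mathcomp Require Import all_classical all_reals all_analysis.
From mathcomp Require Import measurable_realfun.
From mathcomp Require Import ess_sup_inf ring lra.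

Set Implicit Arguments.
Unset Strict Implicit.
Unset Printing Implicit Defensive.

Import Order.TTheory GRing.Theory Num.Theory.
Import numFieldNormedType.Exports.

Local Open Scope classical_set_scope.
Local Open Scope ring_scope.

(** * Second-moment inequalities on a probability space *)

Section MeanSquare.
Context {d : measure_display} {T : measurableType d} {R : realType}.
Variable P : probability T R.

Let Pfin : P setT \is a fin_num := fin_num_measure P _ measurableT.

Lemma Lfun2_Lfun1 (f : T -> R) : f \in Lfun P 2%:E -> f \in Lfun P 1.
Proof. exact: Lfun_subset12. Qed.

Lemma expectation_ae_eq (f g : T -> R) :
  measurable_fun setT f -> measurable_fun setT g ->
  {ae P, forall w, f w = g w} -> ('E_P[f] = 'E_P[g])%E.
Proof.
move=> mf mg fg; rewrite unlock; apply: ae_eq_integral => //.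
- exact/measurable_EFinP.
- exact/measurable_EFinP.
- by apply: filterS fg => w -> _.
Qed.

(** The essential supremum of [f] is at most [M], and on a finite measure space an essentially
    bounded function belongs to every $L^q$. *)
Lemma ae_bounded_Lfun (f : T -> R) (M : R) (q : \bar R) : (1 <= q)%E ->
  measurable_fun setT f -> {ae P, forall w, `|f w| <= M} -> f \in Lfun P q.
Proof.
move=> q1 mf fM; apply: (@Lfun_subset _ _ _ P q +oo%E) => //; rewrite ?leey//.
rewrite inE; apply/andP; split; rewrite inE//=.
rewrite /finite_norm unlock /Lnorm.
case: ifPn => // _.
apply: (@le_lt_trans _ _ M%:E); last exact: ltry.
by apply/ess_supP; apply: filterS fM => w /=; rewrite lee_fin.
Qed.

(** Cauchy-Schwarz for the covariance. [covariance_le] bounds it only from above, so it is applied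
    to [f] and to [\- f] to control the absolute value. *)
Lemma sqr_covariance_le (f g : T -> R) :
  f \in Lfun P 2%:E -> g \in Lfun P 2%:E ->
  fine (covariance P f g) ^+ 2 <= fine 'V_P[f] * fine 'V_P[g].
Proof.
move=> f2 g2.
have cfin : covariance P f g \is a fin_num.
  by apply: covariance_fin_num; [exact: Lfun2_Lfun1..|exact: Lfun2_mul_Lfun1].
have nf2 : (\- f)%R \in Lfun P 2%:E by rewrite rpredN.
have := covariance_le nf2 g2; have := covariance_le f2 g2.
rewrite varianceN// covarianceNl; [|exact: Lfun2_Lfun1..|exact: Lfun2_mul_Lfun1].
have := variance_ge0 P f => /fine_ge0; have := variance_ge0 P g => /fine_ge0.
rewrite -(fineK cfin) -(fineK (variance_fin_num f2)) -(fineK (variance_fin_num g2)) /=.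
move: (fine _) (fine _) (fine _) => c b a b0 a0.
rewrite -EFinM !lee_fin => h1 h2.
rewrite -(sqr_sqrtr a0) -(sqr_sqrtr b0) -exprMn -(real_normK (num_real c)).
rewrite lerXn2r ?nnegrE ?mulr_ge0 ?sqrtr_ge0//.
by rewrite ler_norml h1 lerNl h2.
Qed.

(** This is the nonnegativity of $E[f^2] - E[f]^2$. *)
Lemma sqr_expectation_le (f : T -> R) : f \in Lfun P 2%:E ->
  fine ('E_P[f])%E ^+ 2 <= fine ('E_P[f ^+ 2])%E.
Proof.
move=> f2; have := variance_ge0 P f; rewrite varianceE//.
have Ef : ('E_P[f] \is a fin_num)%E by rewrite expectation_fin_num// Lfun2_Lfun1.
have Ef2 : ('E_P[f ^+ 2] \is a fin_num)%E.
  by rewrite expectation_fin_num//; exact: Lfun2_mul_Lfun1.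
by rewrite -(fineK Ef) -(fineK Ef2) -EFin_expe -EFinB lee_fin subr_ge0.
Qed.

Lemma fine_variance_le (f : T -> R) : f \in Lfun P 2%:E ->
  fine 'V_P[f] <= fine ('E_P[f ^+ 2])%E.
Proof.
move=> f2; rewrite varianceE//.
have Ef : ('E_P[f] \is a fin_num)%E by rewrite expectation_fin_num// Lfun2_Lfun1.
have Ef2 : ('E_P[f ^+ 2] \is a fin_num)%E.
  by rewrite expectation_fin_num//; exact: Lfun2_mul_Lfun1.
by rewrite -(fineK Ef) -(fineK Ef2) -EFin_expe -EFinB lerBlDr lerDl sqr_ge0.
Qed.

(** Chebyshev's inequality without centering: Markov's inequality for the function $x \mapsto
    x^2$. *)
Lemma probability_norm_ge_le (f : {RV P >-> R}) (e : R) : 0 < e ->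
  (P [set w | (e <= `|f w|)%R] <= (e ^- 2)%:E * 'E_P[(f : T -> R) ^+ 2])%E.
Proof.
move=> e0; rewrite -lee_pdivrMl; last by rewrite invr_gt0// exprn_gt0.
rewrite invrK.
have mf2 : measurable_fun setT ((f : T -> R) ^+ 2) by exact: measurable_funM.
have := @markov _ _ _ P f (fun x => x ^+ 2) e e0.
move=> /(_ (measurable_funX _ _) (fun r _ => sqr_ge0 r) _)/le_trans; apply.
- exact: measurable_id.
- by move=> x y; rewrite !nnegrE => x0 y0; rewrite ler_sqr.
- apply: expectation_le => //.
  + by apply: measurable_funX; exact: measurableT_comp.
  + by move=> x /=; exact: sqr_ge0.
  + by move=> x /=; exact: sqr_ge0.
  + by apply/aeW => t /=; rewrite real_normK ?num_real.
Qed.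

End MeanSquare.

(** Squeeze $0 \le |u_n| \le \sqrt{q_n}$, using continuity of the square root at 0. *)
Lemma cvg0_sqr_le (R : realType) (u q : R^nat) :
  (forall n, u n ^+ 2 <= q n) -> q @ \oo --> 0 -> u @ \oo --> 0.
Proof.
move=> uq q0; apply/norm_cvg0P.
have sq0 : Num.sqrt (q n) @[n --> \oo] --> 0.
  by rewrite -(sqrtr0 R); apply: continuous_cvg q0; exact: sqrt_continuous.
apply: (squeeze_cvgr _ (cvg_cst 0) sq0).
by apply: nearW => n; rewrite normr_ge0 -sqrtr_sqr ler_wsqrtr.
Qed.

(** * Consequences of convergence in mean square *)

Section MeanSquareLimit.
Context {d : measure_display} {T : measurableType d} {R : realType}.
Variable P : probability T R.

(** If $U \le x$, then either $V \le x + e$ or $|U - V| \ge e$; the second event is bounded by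
    Chebyshev's inequality. *)
Lemma fine_cdf_le (U V : {RV P >-> R}) (x e : R) : 0 < e ->
  (U \- V : T -> R) \in Lfun P 2%:E ->
  fine (cdf U x) <= fine (cdf V (x + e))
                    + e ^- 2 * fine ('E_P[(U \- V : T -> R) ^+ 2])%E.
Proof.
move=> e0 UV2.
have Efin : ('E_P[(U \- V : T -> R) ^+ 2] \is a fin_num)%E.
  by rewrite expectation_fin_num//; exact: Lfun2_mul_Lfun1.
have cfin (W : {RV P >-> R}) y : cdf W y \is a fin_num by exact: fin_num_measure.
rewrite -lee_fin EFinD EFinM !fineK//.
rewrite -[cdf U x]/(P (U @^-1` `]-oo, x])).
rewrite -[cdf V _]/(P (V @^-1` `]-oo, x + e])).
have mV : measurable (V @^-1` `]-oo, x + e]) by exact: measurable_funPTI.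
have mD : measurable [set w | e <= `|U w - V w|].
  rewrite (_ : [set w | _] = setT `&` (fun w => `|U w - V w|) @^-1` `[e, +oo[).
    have : measurable_fun setT (fun w => `|U w - V w|).
      by apply: measurableT_comp => //; exact: measurable_funB.
    exact.
  by rewrite setTI; apply/seteqP; split=> w /=; rewrite in_itv/= andbT.
apply: (@le_trans _ _ (P (V @^-1` `]-oo, x + e] `|` [set w | e <= `|U w - V w|]))).
  apply: le_measure; rewrite ?inE//; first exact: measurable_funPTI.
    exact: measurableU.
  move=> w /=; rewrite !in_itv/= => Ux.
  have [Vx|Vx] := leP (V w) (x + e); [by left|right].
  by rewrite distrC ler_normr; apply/orP; left; lra.
apply: (le_trans (measureU2 _ mV mD)); apply: leeD => //.
exact: (@probability_norm_ge_le _ _ _ P (U \- V)).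
Qed.

Variables (Y : nat -> {RV P >-> R}) (Z : {RV P >-> R}).
Hypothesis Y2 : forall n, (Y n : T -> R) \in Lfun P 2%:E.
Hypothesis Z2 : (Z : T -> R) \in Lfun P 2%:E.
Hypothesis YZ : fine ('E_P[(Y n \- Z : T -> R) ^+ 2])%E @[n --> \oo] --> (0 : R).

Let YZ2 n : (Y n \- Z : T -> R) \in Lfun P 2%:E.
Proof. by rewrite rpredB ?lee1n. Qed.

Lemma mean_square_expectation : ('E_P[Y n] @[n --> \oo] --> 'E_P[Z])%E.
Proof.
have Efin (f : T -> R) : f \in Lfun P 2%:E -> 'E_P[f]%E \is a fin_num.
  by move=> f2; rewrite expectation_fin_num// Lfun2_Lfun1.
rewrite -(fineK (Efin _ Z2)); apply/fine_cvgP; split.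
  by apply: nearW => n; exact: Efin.
apply/subr_cvg0; apply: cvg0_sqr_le YZ => n /=.
rewrite -fineB ?Efin// -expectationB ?Lfun2_Lfun1//.
exact: sqr_expectation_le.
Qed.

(** Expanding $Y_n = (Y_n - Z) + Z$ gives $V[Y_n] - V[Z] = V[Y_n - Z] + 2\,\mathrm{Cov}(Y_n - Z,
    Z)$. The variance is at most the mean square error, and Cauchy-Schwarz makes the covariance
    vanish in the limit. *)
Lemma mean_square_variance : 'V_P[Y n] @[n --> \oo] --> 'V_P[Z].
Proof.
have cfin (f g : T -> R) : f \in Lfun P 2%:E -> g \in Lfun P 2%:E ->
    covariance P f g \is a fin_num.
  by move=> *; apply: covariance_fin_num; [exact: Lfun2_Lfun1..|exact: Lfun2_mul_Lfun1].
rewrite -(fineK (variance_fin_num Z2)); apply/fine_cvgP; split.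
  by apply: nearW => n; exact: variance_fin_num.
apply/subr_cvg0.
have VE n : fine 'V_P[Y n] - fine 'V_P[Z] =
    fine 'V_P[Y n \- Z] + 2 * fine (covariance P (Y n \- Z) Z).
  rewrite [in LHS](_ : (Y n : T -> R) = (Y n \- Z) \+ Z); last first.
    by apply/funext => w /=; rewrite subrK.
  rewrite varianceD// !fineD ?fin_numD ?fin_numM ?variance_fin_num ?cfin//.
  by rewrite fineM ?cfin//=; ring.
rewrite /comp; under eq_fun do rewrite VE.
rewrite -[0](addr0 0) -[X in _ + X](mulr0 2); apply: cvgD; last apply: cvgMr.
  apply: (squeeze_cvgr _ (cvg_cst 0) YZ); apply: nearW => n.
  by rewrite fine_ge0 ?variance_ge0//= fine_variance_le.
apply: (@cvg0_sqr_le _ _ (fun n =>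
    fine ('E_P[(Y n \- Z : T -> R) ^+ 2])%E * fine 'V_P[Z])).
  move=> n; apply: (le_trans (sqr_covariance_le _ _)) => //.
  by rewrite ler_wpM2r ?fine_ge0 ?variance_ge0// fine_variance_le.
by rewrite -[0](mul0r (fine 'V_P[Z])); apply: cvgMl.
Qed.

(** With $q_n = t^{-2} E[(Y_n - Z)^2]$, one has $F_Z(x - t) - q_n \le F_{Y_n}(x) \le F_Z(x + t) +
    q_n$. Continuity of $F_Z$ at $x$ fixes $t$ first, then $n$ is taken large. *)
Lemma mean_square_cvg_in_distribution : cvg_in_distribution Y Z.
Proof.
move=> x; rewrite /prop_for => Zx.
have cfin (W : {RV P >-> R}) y : cdf W y \is a fin_num by exact: fin_num_measure.
move: Zx; rewrite /continuous_at -(fineK (cfin Z x)) => /fine_cvgP[_ Zx].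
apply/fine_cvgP; split; first by apply: nearW => n; exact: cfin.
apply/cvgrPdist_lt => e e0.
have e20 : 0 < e / 2 by rewrite divr_gt0.
have /cvgrPdist_lt/(_ _ e20)/nbhs_ballP[r /= r0 xr] := Zx.
(* Half the radius keeps both [x + t] and [x - t] inside the open ball on which the cdf of [Z]
   varies by less than [e / 2]. *)
pose t := r / 2.
have t0 : 0 < t by rewrite divr_gt0.
have tr : t < r by rewrite /t; lra.
have Zp : `|fine (cdf Z x) - fine (cdf Z (x + t))| < e / 2.
  by apply: xr; rewrite /ball/= opprD addNKr normrN gtr0_norm.
have Zm : `|fine (cdf Z x) - fine (cdf Z (x - t))| < e / 2.
  by apply: xr; rewrite /ball/= opprD addNKr opprK gtr0_norm.
have q0 : t ^- 2 * fine ('E_P[(Y n \- Z : T -> R) ^+ 2])%E @[n --> \oo] --> (0 : R).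
  by rewrite -[0](mulr0 (t ^- 2)); apply: cvgMr.
have /cvgrPdist_lt/(_ _ e20) := q0.
apply: filterS => n /=; rewrite sub0r normrN => /(le_lt_trans (ler_norm _)) qn.
have h1 := @fine_cdf_le (Y n) Z x t t0 (YZ2 n).
have ZY2 : (Z \- Y n : T -> R) \in Lfun P 2%:E by rewrite rpredB ?lee1n.
(* Exchanging the roles of [Z] and [Y n] and starting from [x - t] gives the lower bound at [x]. *)
have := @fine_cdf_le Z (Y n) (x - t) t t0 ZY2.
rewrite subrK.
have -> : (Z \- Y n : T -> R) ^+ 2 = (Y n \- Z : T -> R) ^+ 2.
  by apply/funext => w; rewrite /GRing.exp/= -mulrNN !opprB.
move: Zp Zm h1 qn; rewrite !ltr_norml => /andP[? ?] /andP[? ?] ? ? ?.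
by apply/andP; split; lra.
Qed.

End MeanSquareLimit.

(** * Moments of finite sums of uncorrelated variables *)

Section UncorrelatedSum.
Context {d : measure_display} {T : measurableType d} {R : realType}.
Variables (P : probability T R) (f : nat -> T -> R).

Lemma Lfun2_sum_nat m n : (forall i, (m <= i)%N -> f i \in Lfun P 2%:E) ->
  (\sum_(m <= i < n) f i) \in Lfun P 2%:E.
Proof.
move=> f2; rewrite big_nat.
apply: (big_ind (fun g : T -> R => g \in Lfun P 2%:E)) => [|g h g2 h2|i /andP[mi _]].
- exact: Lfun_cst.
- by rewrite rpredD ?lee1n.
- exact: f2.
Qed.

Lemma covariance_suml m n (g : T -> R) :
  (forall i, (m <= i)%N -> f i \in Lfun P 2%:E) -> g \in Lfun P 2%:E ->
  covariance P (\sum_(m <= i < n) f i) g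
  = (\sum_(m <= i < n) covariance P (f i) g)%E.
Proof.
move=> f2 g2; have [nm|/ltnW mn] := leqP n m.
  by rewrite !big_geq// covariance_cst_l.
rewrite -(subnKC mn); move: (n - m)%N => k; elim: k => [|k IH].
  by rewrite addn0 !big_geq// covariance_cst_l.
rewrite addnS !big_nat_recr ?leq_addr//= -IH -covarianceDl ?f2 ?leq_addr//.
exact: Lfun2_sum_nat.
Qed.

(** Induction on the number of terms: by linearity, the last term has zero covariance with the sum
    of the earlier ones. *)
Lemma variance_sum_uncorrelated m n :
  (forall i, (m <= i)%N -> f i \in Lfun P 2%:E) ->
  (forall i j, (m <= i < j)%N -> covariance P (f i) (f j) = 0%E) ->
  'V_P[\sum_(m <= i < n) f i] = (\sum_(m <= i < n) 'V_P[f i])%E.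
Proof.
move=> f2 f0; have [nm|/ltnW mn] := leqP n m.
  by rewrite !big_geq// variance_cst.
rewrite -(subnKC mn); move: (n - m)%N => k; elim: k => [|k IH].
  by rewrite addn0 !big_geq// variance_cst.
have c0 : covariance P (\sum_(m <= i < m + k) f i) (f (m + k)%N) = 0%E.
  rewrite covariance_suml ?f2 ?leq_addr// big_nat big1// => i /andP[mi ik].
  by rewrite f0// mi.
rewrite addnS !big_nat_recr ?leq_addr//= -IH varianceD ?f2 ?leq_addr//.
  by rewrite c0 mule0 adde0.
exact: Lfun2_sum_nat.
Qed.

Lemma expectation_sum_nat m n : (forall i, (m <= i)%N -> f i \in Lfun P 1) ->
  ('E_P[\sum_(m <= i < n) f i] = \sum_(m <= i < n) 'E_P[f i])%E.
Proof.
move=> f1; have := @expectation_sum _ _ _ P [seq f i | i <- index_iota m n].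
rewrite !big_map; apply => g /mapP[i]; rewrite mem_index_iota => /andP[mi _] ->.
exact: f1.
Qed.

End UncorrelatedSum.

(** * Random signs: moments, covariances and laws *)

Section SignLaw.
Context {d : measure_display} {T : measurableType d} {R : realType}.
Variable P : probability T R.

(** The two events are disjoint and their probabilities $p$ and $1 - p$ add up to 1, so the
    complement of their union is negligible. *)
Lemma sign_law_ae p (Y : {RV P >-> R}) : sign_law p Y ->
  {ae P, forall w, Y w = 1 \/ Y w = -1}.
Proof.
move=> [Y1 Ym1].
have m1 r : measurable (Y @^-1` [set r]) by exact: measurable_funPTI.
have PU : P (Y @^-1` [set 1] `|` Y @^-1` [set -1]) = 1%E.
  rewrite measureU//.
    by rewrite -[LHS]/(P (Y @^-1` [set 1%R]) + P (Y @^-1` [set (-1)%R]))%E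
      Y1 Ym1 -EFinD subrKC.
  apply/seteqP; split => w //= [-> /eqP].
  by rewrite -subr_eq0 opprK (_ : 1 + 1 = 2%:R)// pnatr_eq0.
exists (~` (Y @^-1` [set 1] `|` Y @^-1` [set -1])); split => //.
- by apply: measurableC; exact: measurableU.
- rewrite probability_setC; last exact: measurableU.
  by rewrite PU subee.
Qed.

Lemma sign_law_Lfun p (Y : {RV P >-> R}) q : (1 <= q)%E -> sign_law p Y ->
  (Y : T -> R) \in Lfun P q.
Proof.
move=> q1 /sign_law_ae Y1; apply: (@ae_bounded_Lfun _ _ _ _ _ 1) => //.
by apply: filterS Y1 => w [] ->; rewrite ?normrN normr1.
Qed.

(* Turns expectations and covariances of signs into probabilities of the events
   [Y = 1] and of their intersections. *)
Lemma sign_law_indic p (Y : {RV P >-> R}) : sign_law p Y ->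
  {ae P, forall w, Y w = (2 \o* \1_(Y @^-1` [set 1]) \- cst 1) w}.
Proof.
move=> /sign_law_ae; apply: filterS => w /= Yw.
rewrite indicE; case: Yw => Yw.
  by rewrite mem_set//= Yw; lra.
rewrite memNset/= ?Yw; first lra.
by move/eqP; rewrite -subr_eq0 -opprD oppr_eq0 (_ : 1 + 1 = 2%:R)// pnatr_eq0.
Qed.

Lemma measurable_sign_indic (A : set T) : measurable A ->
  measurable_fun setT (2 \o* \1_A \- cst 1 : T -> R).
Proof.
by move=> mA; apply: measurable_funB => //; exact: measurable_funM.
Qed.

Lemma indic_Lfun (A : set T) q : (1 <= q)%E -> measurable A ->
  (\1_A : T -> R) \in Lfun P q.
Proof.
move=> q1 mA; apply: (@ae_bounded_Lfun _ _ _ _ _ 1) => //.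
by apply: aeW => w; rewrite indicE; case: (_ \in _); rewrite ?normr1 ?normr0.
Qed.

Lemma sign_law_expectation p (Y : {RV P >-> R}) : sign_law p Y ->
  'E_P[Y]%E = (2 * p - 1)%:E.
Proof.
move=> Yp; have mA : measurable (Y @^-1` [set 1]) by exact: measurable_funPTI.
rewrite (expectation_ae_eq _ (measurable_sign_indic mA) (sign_law_indic Yp))//.
rewrite expectationB ?Lfun_cst ?Lfun_scale ?indic_Lfun//.
rewrite expectationZl ?indic_Lfun// expectation_indic// expectation_cst.
by rewrite Yp.1.
Qed.

(** Almost surely $Y^2 = 1$, and the mean is $2p - 1$. *)
Lemma sign_law_variance p (Y : {RV P >-> R}) : sign_law p Y ->
  'V_P[Y]%E = (1 - (2 * p - 1) ^+ 2)%:E.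
Proof.
move=> Yp; rewrite varianceE; last by apply: sign_law_Lfun Yp; rewrite lee1n.
rewrite (sign_law_expectation Yp) (@expectation_ae_eq _ _ _ P _ (cst 1))//.
- by rewrite expectation_cst.
- by apply: filterS (sign_law_ae Yp) => w [] h;
    rewrite -[LHS]/(Y w * Y w) h ?mulrNN mulr1.
Qed.

Lemma covariance_ae_eq (f g f' g' : T -> R) :
  measurable_fun setT f -> measurable_fun setT g ->
  measurable_fun setT f' -> measurable_fun setT g' ->
  {ae P, forall w, f w = f' w} -> {ae P, forall w, g w = g' w} ->
  covariance P f g = covariance P f' g'.
Proof.
move=> mf mg mf' mg' ff' gg'.
rewrite unlock (expectation_ae_eq mf mf' ff') (expectation_ae_eq mg mg' gg')//.
apply: expectation_ae_eq.
- by apply: measurable_funM; exact: measurable_funB.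
- by apply: measurable_funM; exact: measurable_funB.
- by apply: filterS2 ff' gg' => w h1 h2; rewrite /GRing.mul/= h1 h2.
Qed.

(** Writing $Y = 2 \cdot 1_A - 1$ and $Z = 2 \cdot 1_B - 1$ almost surely, the covariance is $4 (P(A
    \cap B) - P(A) P(B))$, so independence of this single pair of events suffices. *)
Lemma sign_law_covariance p q (Y Z : {RV P >-> R}) :
  sign_law p Y -> sign_law q Z ->
  P (Y @^-1` [set 1] `&` Z @^-1` [set 1])
    = (P (Y @^-1` [set 1%R]) * P (Z @^-1` [set 1%R]))%E ->
  covariance P Y Z = 0%E.
Proof.
move=> Yp Zq YZ.
set A := Y @^-1` _ in YZ; set B := Z @^-1` _ in YZ.
have mA : measurable A by exact: measurable_funPTI.
have mB : measurable B by exact: measurable_funPTI.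
have le12 : (1 <= 2%:E :> \bar R)%E by rewrite lee1n.
rewrite (covariance_ae_eq _ _
  (measurable_sign_indic mA) (measurable_sign_indic mB)
  (sign_law_indic Yp) (sign_law_indic Zq))//.
have AB : (\1_A * \1_B : T -> R) = \1_(A `&` B) by rewrite indicI.
rewrite covarianceBl ?rpredB ?Lfun_cst ?Lfun_scale ?indic_Lfun ?ler1n//.
rewrite covariance_cst_l sube0 covarianceBr ?Lfun_cst ?Lfun_scale ?indic_Lfun ?ler1n//.
rewrite covariance_cst_r sube0.
have ABL : (\1_A * \1_B : T -> R) \in Lfun P 1.
  by rewrite AB indic_Lfun//; exact: measurableI.
rewrite covarianceZl ?Lfun_scale ?indic_Lfun//; last first.
  by apply: Lfun2_mul_Lfun1; rewrite ?Lfun_scale ?indic_Lfun ?ler1n.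
rewrite covarianceZr ?indic_Lfun// covarianceE ?indic_Lfun//.
rewrite AB !expectation_indic//; last exact: measurableI.
by rewrite YZ subee ?mule0// fin_numM// fin_num_measure.
Qed.

(** Almost surely $1_A(Z) = 1_A(a) 1_{\{Y = 1\}} + 1_A(-a) 1_{\{Y = -1\}}$; taking expectations
    yields the mixture of Dirac masses, even when $a = 0$. *)
Lemma sign_law_two_point p a (Y Z : {RV P >-> R}) : sign_law p Y ->
  (forall w, Z w = a * Y w) -> two_point_law Z a (- a) p.
Proof.
move=> Yp ZY A mA.
have m1 r : measurable (Y @^-1` [set r]) by exact: measurable_funPTI.
have mZ : measurable (Z @^-1` A) by exact: measurable_funPTI.
have neq1N1 : (1 : R) != -1.
  by rewrite -subr_eq0 opprK (_ : 1 + 1 = 2%:R)// pnatr_eq0.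
rewrite -[LHS]/(P (Z @^-1` A)) -expectation_indic//.
rewrite (@expectation_ae_eq _ _ _ P _ (\1_A a \o* \1_(Y @^-1` [set 1])
    \+ \1_A (- a) \o* \1_(Y @^-1` [set -1])))//; last 2 first.
- by apply: measurable_funD; apply: measurable_funM.
- apply: filterS (sign_law_ae Yp) => w.
  rewrite -[\1__ w]/(\1_A (Z w)) ZY.
  rewrite -[X in _ -> _ = X]/(\1_[set (1 : R)] (Y w) * \1_A a
    + \1_[set (-1 : R)] (Y w) * \1_A (- a)) !indicE !in_set1.
  move=> [] ->; rewrite eqxx.
    by rewrite (negbTE neq1N1) mul1r mul0r addr0 mulr1.
  by rewrite eq_sym (negbTE neq1N1) mul1r mul0r add0r mulrN1.
rewrite expectationD ?Lfun_scale ?indic_Lfun//.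
rewrite !expectationZl ?indic_Lfun// !expectation_indic//.
by rewrite Yp.1 Yp.2 muleC; congr (_ + _)%E; rewrite muleC.
Qed.

End SignLaw.

Lemma mutually_independent_pair (d : measure_display) (T : measurableType d)
    (R : realType) (P : probability T R) (I : set nat) (Y : nat -> {RV P >-> R})
    (i j : nat) (A B : set R) : mutually_independent I Y ->
  I i -> I j -> i <> j -> measurable A -> measurable B ->
  P (Y i @^-1` A `&` Y j @^-1` B) = (P (Y i @^-1` A) * P (Y j @^-1` B))%E.
Proof.
move=> indY Ii Ij ij mA mB.
(* The product rule for $\{i, j\}$ needs a family of sets indexed by all naturals; since [i <> j],
   this one takes the value [B] at [j]. *)
pose C k := if k == i then A else B.
have ji : (j == i) = false by apply/eqP => /esym.
have := indY [fset i; j]%fset C.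
have -> : \bigcap_(k in [set` [fset i; j]%fset]) (Y k @^-1` C k)
    = Y i @^-1` A `&` Y j @^-1` B.
  apply/seteqP; split => w /=.
    move=> h; split.
      by have := h i; rewrite /C eqxx; apply; rewrite /= !inE eqxx.
    by have := h j; rewrite /C ji; apply; rewrite /= !inE eqxx orbT.
  move=> [wA wB] k /=; rewrite !inE => /orP[]/eqP ->; rewrite /C ?eqxx ?ji//.
rewrite big_fsetU1 ?inE; last by apply/eqP.
rewrite big_seq_fset1 /C eqxx ji; apply.
- by move=> k /=; rewrite !inE => /orP[]/eqP ->.
- by move=> k; case: ifP.
Qed.

(** * Mean square error of $S_n / n$ *)

Section WalkMean.
Context {d : measure_display} {T : measurableType d} {R : realType}.
Variables (P : probability T R) (p : R) (X eps : nat -> {RV P >-> R}).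
Hypothesis X1p : sign_law p (X 1%N).
Hypothesis epsp : forall i, (2 <= i)%N -> sign_law p (eps i).
Hypothesis eps_ind : mutually_independent [set i | (2 <= i)%N] eps.
Hypothesis Xeps : forall n, (1 <= n)%N ->
  {ae P, forall w, X n.+1 w = eps n.+1 w * X 1 w}.

Let le12 : (1 <= 2%:E :> \bar R)%E. Proof. by rewrite lee1n. Qed.

Let eps2 i : (2 <= i)%N -> (eps i : T -> R) \in Lfun P 2%:E.
Proof. by move=> /epsp; exact: sign_law_Lfun. Qed.

Let drift : R := 2 * p - 1.

Lemma step_Lfun2 k : (1 <= k)%N -> (X k : T -> R) \in Lfun P 2%:E.
Proof.
case: k => // -[_|k _]; first exact: (sign_law_Lfun _ X1p).
apply: (@ae_bounded_Lfun _ _ _ _ _ 1) => //.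
have k2 : (2 <= k.+2)%N by [].
apply: filterS3 (Xeps (ltn0Sn k)) (sign_law_ae (epsp k2)) (sign_law_ae X1p).
by move=> w -> [] -> [] ->; rewrite ?mulrNN ?mul1r ?mulr1 ?normrN normr1.
Qed.

Lemma walk_mean_Lfun2 n : walk_mean X n \in Lfun P 2%:E.
Proof.
rewrite (_ : walk_mean X n = n%:R^-1 \o* \sum_(1 <= k < n.+1) (X k : T -> R)).
  by rewrite Lfun_scale ?ler1n//; exact: (Lfun2_sum_nat _ step_Lfun2).
by apply/funext => w; rewrite /walk_mean /walk /= fct_sumE.
Qed.

(** This is $n (M_n - m)$ with $m$ = [drift]. The constant 1 is the factor of the first step, $X_1 =
    1 \cdot X_1$, so that $S_n - n m X_1$ equals [noise n] times $X_1$ almost surely. *)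
Let noise n : T -> R :=
  \sum_(2 <= k < n.+1) (eps k : T -> R) \+ cst (1 - n%:R * drift).

(** Squared mean plus variance. The $n - 1$ innovations give the mean $(n - 1) m + 1 - n m = 1 - m$,
    and, being pairwise uncorrelated, the variance $(n - 1)(1 - m^2)$. *)
Lemma noise_second_moment n : (1 <= n)%N ->
  ('E_P[noise n ^+ 2])%E = ((1 - drift) ^+ 2 + n.-1%:R * (1 - drift ^+ 2))%:E.
Proof.
move=> n1.
have S2 : \sum_(2 <= k < n.+1) (eps k : T -> R) \in Lfun P 2%:E.
  exact: (Lfun2_sum_nat _ eps2).
have N2 : noise n \in Lfun P 2%:E by rewrite rpredD ?Lfun_cst.
have Efin : ('E_P[noise n] \is a fin_num)%E.
  by rewrite expectation_fin_num// Lfun2_Lfun1.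
have EN : ('E_P[noise n] = (1 - drift)%:E)%E.
  rewrite expectationD ?Lfun_cst ?Lfun2_Lfun1// expectation_cst.
  rewrite expectation_sum_nat; last by move=> i /eps2; exact: Lfun2_Lfun1.
  rewrite (eq_big_nat _ _ (F2 := fun=> drift%:E)); last first.
    by move=> i /andP[/epsp/sign_law_expectation].
  rewrite sumEFin sumr_const_nat -EFinD subSS; congr EFin.
  by rewrite -(mulr_natl drift) natrB//; ring.
have VN : ('V_P[noise n] = (n.-1%:R * (1 - drift ^+ 2))%:E)%E.
  rewrite varianceD_cst_r// variance_sum_uncorrelated//.
    rewrite (eq_big_nat _ _ (F2 := fun=> (1 - drift ^+ 2)%:E)); last first.
      by move=> i /andP[/epsp/sign_law_variance].
    by rewrite sumEFin sumr_const_nat subSS subn1 -(mulr_natl (1 - drift ^+ 2)).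
  move=> i j /andP[i2 ij].
  have j2 : (2 <= j)%N by exact: (leq_trans i2 (ltnW ij)).
  apply: (sign_law_covariance (epsp i2) (epsp j2)).
  apply: (mutually_independent_pair eps_ind) => //.
  by move=> e; move: ij; rewrite e ltnn.
(* The identity $V = E[N^2] - E[N]^2$ is solved for $E[N^2]$, which is finite because [noise n] is
   in $L^2$. *)
have := varianceE N2; rewrite EN VN => /esym/eqP.
rewrite -(fineK (_ : 'E_P[noise n ^+ 2] \is a fin_num)%E); last first.
  by rewrite expectation_fin_num//; exact: Lfun2_mul_Lfun1.
rewrite -EFin_expe -EFinB eqe => /eqP h; congr EFin.
by rewrite -h; ring.
Qed.

Lemma walk_mean_error n (Z : {RV P >-> R}) : (1 <= n)%N ->
  (forall w, Z w = drift * X 1 w) ->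
  ('E_P[(walk_mean X n \- Z : T -> R) ^+ 2]
   = ((n%:R ^- 2) * ((1 - drift) ^+ 2 + n.-1%:R * (1 - drift ^+ 2)))%:E)%E.
Proof.
move=> n1 ZX.
have S2 : \sum_(2 <= k < n.+1) (eps k : T -> R) \in Lfun P 2%:E.
  exact: (Lfun2_sum_nat _ eps2).
have N2 : noise n \in Lfun P 2%:E by rewrite rpredD ?Lfun_cst.
have N1 : noise n ^+ 2 \in Lfun P 1 by exact: Lfun2_mul_Lfun1.
rewrite (@expectation_ae_eq _ _ _ P _ (n%:R ^- 2 \o* (noise n ^+ 2))).
- by rewrite expectationZl// noise_second_moment.
- by apply: measurable_funM; exact: measurable_funB.
- apply: measurable_funM => //.
  by move: N1; rewrite inE => /andP[/[!inE]].
(* A countable union of null sets is null, so all step equations hold simultaneously off one null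
   set. *)
have Xall : {ae P, forall w, forall k, (1 <= k)%N -> X k.+1 w = eps k.+1 w * X 1 w}.
  apply: ae_foralln => k; have [k0|k1] := leqP k 0.
    exact: aeW.
  by apply: filterS (Xeps k1).
apply: filterS2 Xall (sign_law_ae X1p) => w XE X1.
have XX : X 1%N w * X 1%N w = 1 by case: X1 => ->; rewrite ?mulrNN mulr1.
have n0 : n%:R != 0 :> R by rewrite pnatr_eq0 -lt0n.
have WE : walk X n w = noise n w * X 1%N w + n%:R * drift * X 1%N w.
  rewrite /walk big_ltn// (eq_big_nat _ _ (F2 := fun k => eps k w * X 1%N w)); last first.
    by case=> // k /andP[k2 _]; exact: XE.
  by rewrite -mulr_suml /noise/= fct_sumE; ring.
rewrite -[LHS]/((walk X n w / n%:R - Z w) * (walk X n w / n%:R - Z w)).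
rewrite -[RHS]/((noise n w * noise n w) * n%:R ^- 2) ZX WE.
(* The factor $X_1^2 = 1$ is inserted; after that the identity is purely algebraic. *)
transitivity (noise n w * noise n w * (X 1%N w * X 1%N w) * n%:R ^- 2); last first.
  by rewrite XX mulr1.
by field.
Qed.

End WalkMean.

Theorem theorem5p1 (R : realType) (d : measure_display) (T : measurableType d)
    (P : probability T R) (p : R) (X : nat -> {RV P >-> R})
    (hp0 : 0 < p) (hp1 : p < 1)
    (hX : first_step_erw p X) (hX1 : sign_law p (X 1%N)) :
  (exists (d' : measure_display) (T' : measurableType d')
      (Q : probability T' R) (Z : {RV Q >-> R}),
      two_point_law Z (2 * p - 1) (- (2 * p - 1)) p
      /\ cvg_in_distribution (fun n => walk_mean X n : {RV P >-> R}) Z)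
  /\ ('E_P[walk_mean X n] @[n --> \oo] --> ((2 * p - 1) ^+ 2)%:E)%E
  /\ ('V_P[walk_mean X n] @[n --> \oo]
        --> (4 * p * (1 - p) * (2 * p - 1) ^+ 2)%:E)%E.
Proof.
case: hX => eps [eps_ind epsp _ Xeps].
(* The limit $m X_1$ is realised on the space of the walk itself, which makes the mean square
   comparison possible. *)
pose Z : {RV P >-> R} := cst (2 * p - 1) \* X 1%N.
have ZE w : Z w = (2 * p - 1) * X 1%N w by [].
have X2 : (X 1%N : T -> R) \in Lfun P 2%:E by apply: sign_law_Lfun hX1; rewrite lee1n.
have Zo : (Z : T -> R) = (2 * p - 1) \o* X 1%N.
  by apply/funext => w; rewrite ZE mulrC.
have Z2 : (Z : T -> R) \in Lfun P 2%:E by rewrite Zo Lfun_scale// ler1n.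
have Y2 n : (walk_mean X n : T -> R) \in Lfun P 2%:E.
  exact: walk_mean_Lfun2 hX1 epsp Xeps n.
have YZ : fine ('E_P[(walk_mean X n \- Z : T -> R) ^+ 2])%E @[n --> \oo] --> (0 : R).
  (* The error formula requires a positive index. With $N = n + 1$ and [harmonic n] $= 1/N$, it
     reads $N^{-2}(a + (N - 1) b) = N^{-2}(a - b) + N^{-1} b$. *)
  rewrite -cvg_shiftS/=.
  set a := (1 - (2 * p - 1)) ^+ 2; set b := 1 - (2 * p - 1) ^+ 2.
  rewrite (_ : (fun n => _) = fun n =>
      harmonic n * harmonic n * (a - b) + harmonic n * b).
    suff : harmonic n * harmonic n * (a - b) + harmonic n * b @[n --> \oo]
        --> 0 * 0 * (a - b) + 0 * b by rewrite !mul0r addr0.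
    by apply: cvgD; apply: cvgMl; first apply: cvgM; exact: cvg_harmonic.
  apply/funext => n; rewrite (walk_mean_error hX1 epsp eps_ind Xeps _ ZE)//=.
  have -> : n%:R = n.+1%:R - 1 :> R by rewrite -natr1 addrK.
  by rewrite /harmonic /= -/a -/b; field; rewrite ?nat1r ?natr1 pnatr_eq0.
split; [|split].
- exists d, T, P, Z; split; first exact: sign_law_two_point hX1 ZE.
  exact: mean_square_cvg_in_distribution.
- have := mean_square_expectation Y2 Z2 YZ.
  by rewrite Zo expectationZl ?Lfun2_Lfun1// (sign_law_expectation hX1) -EFinM -expr2.
- have := mean_square_variance Y2 Z2 YZ.
  rewrite Zo varianceZ// (sign_law_variance hX1) -EFinM.
  (* Here $1 - (2p - 1)^2 = 4p(1 - p)$. *)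
  by rewrite (_ : 4 * p * (1 - p) * (2 * p - 1) ^+ 2
    = (2 * p - 1) ^+ 2 * (1 - (2 * p - 1) ^+ 2))//; ring.
Qed.
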